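(* Let $M$ be a contact $SCR$-lightlike submanifold of an indefinite Kenmotsu statistical manifold $\bar M$. Then neither $D^{\perp}$ nor $\bar D$ defines a totally geodesic foliation on $M$.
   Context: Indefinite Kenmotsu statistical manifold $(\bar M,\bar\nabla,\bar\nabla^{*},\bar g,\phi,\nu)$: $\bar M$ is a $(2n+1)$-dimensional manifold with a semi-Riemannian metric $\bar g$ of constant index $q\ge1$, a torsion-free affine connection $\bar\nabla$ with $(\bar\nabla_X\bar g)(Y,Z)=(\bar\nabla_Y\bar g)(X,Z)$, dual connection $\bar\nabla^{*}$ defined by $X\bar g(Y,Z)=\bar g(\bar\nabla_XY,Z)+\bar g(Y,\bar\nabla^{*}_XZ)$, Levi-Civita connection $\widehat{\bar\nabla}=\frac12(\bar\nabla+\bar\nabla^{*})$, and $K(X,Y)=\bar\nabla_XY-\widehat{\bar\nabla}_XY$. It carries a $(1,1)$-tensor field $\phi$, a vector field $\nu$ and a $1$-form $\eta$ with $\bar g(\phi X,\phi Y)=\bar g(X,Y)-\eta(X)\eta(Y)$, $\bar g(\nu,\nu)=1$, $\phi^2X=-X+\eta(X)\nu$, $\bar g(X,\nu)=\eta(X)$, $\bar g(\phi X,Y)+\bar g(X,\phi Y)=0$, satisfying $(\widehat{\bar\nabla}_X\phi)Y=\eta(Y)\phi X-\bar g(\phi X,Y)\nu$, $\widehat{\bar\nabla}_X\nu=-X+\eta(X)\nu$, and $K(X,\phi Y)=-\phi K(X,Y)$, for all vector fields $X,Y,Z$ on $\bar M$. Lightlike submanifold: a submanifold $M$ of $\bar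 M$ with degenerate induced metric $g$ such that $Rad(TM)=TM\cap TM^{\perp}$ is a distribution of rank $r\ge1$. $S(TM)$ (screen distribution) is a chosen complement of $Rad(TM)$ in $TM$, $TM=Rad(TM)\perp S(TM)$; $S(TM^{\perp})$ (screen transversal bundle) is a chosen complement of $Rad(TM)$ in $TM^\perp$. The lightlike transversal bundle $ltr(TM)$ is locally spanned by sections $N_i$ of the orthogonal complement of $S(TM^\perp)$ in $S(TM)^\perp$ with $\bar g(\xi_i,N_j)=\delta_{ij}$, $\bar g(N_i,N_j)=0$ for a local basis $\{\xi_i\}$ of $Rad(TM)$. Put $tr(TM)=ltr(TM)\perp S(TM^\perp)$, so $T\bar M|_M=TM\oplus tr(TM)$. For $X,Y\in\Gamma(TM)$, $\widehat\nabla_XY$ denotes the $TM$-component of $\widehat{\bar\nabla}_XY$ in this decomposition. Contact $SCR$-lightlike submanifold: a lightlike submanifold $M$ tangent to $\nu$ such that (1) there are real non-empty distributions $D$, $D^\perp$ with $S(TM)=D\perp D^\perp\perp\{\nu\}$, $\phi(D^\perp)\subset S(TM^\perp)$, $D\cap D^\perp=\{0\}$, where $D^\perp$ is the orthogonal complement of $D\perp\{\nu\}$ in $S(TM)$; (2) $D$ and $Rad(TM)$ are invariant under $\phi$ (hence so is $ltr(TM)$). Put $\bar D=D\perp Rad(TM)$, so $TM=\bar D\perp D^\perp\perp\{\nu\}$. A distribution $E$ on $M$ defines a totally geodesic foliation if $\widehat\nabla_XY\in\Gamma(E)$ for all $X,Y\in\Gamma(E)$. *)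

(* Defs.v *)
From HB Require Import structures.
From mathcomp Require Import all_boot all_order all_algebra.
From mathcomp Require Import all_classical all_reals all_analysis.

Set Implicit Arguments.
Unset Strict Implicit.
Unset Printing Implicit Defensive.

Import Order.TTheory GRing.Theory Num.Theory.
Import numFieldNormedType.Exports.

Local Open Scope classical_set_scope.
Local Open Scope ring_scope.

(* The last clause lets [v] be any fixed vector, so in dimension m it says that
   all the partial derivatives are again of class C^k. *)
Fixpoint class_C (R : realType) (m : nat) (W : normedModType R) (k : nat)
    (U : set 'rV[R]_m) (f : 'rV[R]_m -> W) : Prop :=
  match k with
  | 0 => forall x, U x -> {for x, continuous f}
  | k'.+1 => (forall x, U x -> differentiable f x) /\
             (forall v, class_C k' U (fun x => 'd f x v))
  end.

Definition class_Coo (R : realType) (m : nat) (W : normedModType R)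
    (U : set 'rV[R]_m) (f : 'rV[R]_m -> W) : Prop :=
  forall k, class_C k U f.

(* [cmap] and [cinv] are total functions; only their restrictions to [cdom] and
   to its (open) image, where they are inverse homeomorphisms, are relevant. *)
Record chart (R : realType) (m : nat) (M : topologicalType) := Chart {
  cdom : set M ;
  cmap :> M -> 'rV[R]_m ;
  cinv : 'rV[R]_m -> M ;
  cdom_open : open cdom ;
  cimg_open : open (cmap @` cdom) ;
  cmapK : forall p, cdom p -> cinv (cmap p) = p ;
  cmap_continuous : forall p, cdom p -> {for p, continuous cmap} ;
  cinv_continuous :
    forall x, (cmap @` cdom) x -> {for x, continuous cinv} }.

Record manifold (R : realType) (m : nat) := Manifold {
  points :> topologicalType ;
  atlas : set (chart R m points) ;
  chart_at : points -> chart R m points ;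
  points_hausdorff : hausdorff_space points ;
  points_second_countable : @second_countable points ;
  chart_at_atlas : forall p, atlas (chart_at p) ;
  chart_at_dom : forall p, cdom (chart_at p) p ;
  atlas_compatible : forall c d, atlas c -> atlas d ->
    class_Coo (c @` (cdom c `&` cdom d)) (d \o cinv c) }.

Section Manifolds.
Context {R : realType}.

(* Every tangent space T_pM is realized as R^m by means of the components of
   tangent vectors in the preferred chart [chart_at M p]. *)
Definition field (m : nat) (M : manifold R m) := M -> 'rV[R]_m.

Section OneManifold.
Context {m : nat} (M : manifold R m).

Definition smooth_fun (W : normedModType R) (U : set M) (f : M -> W) : Prop :=
  forall c, atlas c -> class_Coo (c @` (U `&` cdom c)) (f \o cinv c).

Definition dirder (W : normedModType R) (f : M -> W) (p : M)
    (v : 'rV[R]_m) : W :=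
  'd (f \o cinv (chart_at p)) (chart_at p p) v.

End OneManifold.

Section Maps.
Context {m n : nat} {M : manifold R m} {N : manifold R n}.

Definition smooth_map (h : M -> N) : Prop :=
  continuous h /\
  forall c, atlas c -> smooth_fun (h @^-1` cdom c) (c \o h).

Definition tangent_map (h : M -> N) (p : M) : 'rV[R]_m -> 'rV[R]_n :=
  dirder (chart_at (h p) \o h) p.

Definition immersion (h : M -> N) : Prop :=
  smooth_map h /\ forall p, injective (tangent_map h p).

(* Vector fields along [h] over the open set [U], i.e., sections of h^*TN:
   [V p] belongs to the tangent space of N at [h p], and [dirder c (h p) (V p)]
   is the row of its components in the chart [c]. *)
Definition smooth_along (h : M -> N) (U : set M) (V : M -> 'rV[R]_n) : Prop :=
  forall c, atlas c ->
    smooth_fun (U `&` h @^-1` cdom c) (fun p => dirder c (h p) (V p)).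

Definition subbundle_rank (h : M -> N) (k : nat)
    (E : M -> {vspace 'rV[R]_n}) : Prop :=
  (forall p, \dim (E p) = k) /\
  forall p, exists (U : set M) (s : 'I_k -> M -> 'rV[R]_n),
    [/\ open U, U p, forall i, smooth_along h U (s i) &
        forall x, U x -> E x = <<[seq s i x | i : 'I_k]>>%VS].

Definition subbundle (h : M -> N) (E : M -> {vspace 'rV[R]_n}) : Prop :=
  exists k, subbundle_rank h k E.

Definition is_section (h : M -> N) (E : M -> {vspace 'rV[R]_n})
    (V : M -> 'rV[R]_n) : Prop :=
  smooth_along h setT V /\ forall p, V p \in E p.

End Maps.

Definition smooth_field (m : nat) (M : manifold R m) (X : field M) : Prop :=
  smooth_along (idfun : M -> M) setT X.

Section Forms.
Context {m : nat}.
Implicit Types b : 'rV[R]_m -> 'rV[R]_m -> R.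

Definition orthov b (U : {vspace 'rV[R]_m}) : {vspace 'rV[R]_m} :=
  (\bigcap_(i < \dim U) lker (linfun (fun v => b v (vbasis U)`_i : R^o)))%VS.

Definition orthogonal_spaces b (U V : {vspace 'rV[R]_m}) : Prop :=
  forall u v, u \in U -> v \in V -> b u v = 0.

Definition negative_definite_on b (U : {vspace 'rV[R]_m}) : Prop :=
  forall u, u \in U -> u != 0 -> b u u < 0.

Definition has_index b (q : nat) : Prop :=
  (exists2 U, negative_definite_on b U & \dim U = q) /\
  forall U, negative_definite_on b U -> (\dim U <= q)%N.

Lemma mem_orthov b (U : {vspace 'rV[R]_m}) (v : 'rV[R]_m) :
    (forall u, linear (b u : _ -> R^o)) -> (forall u w, b u w = b w u) ->
  (v \in orthov b U) <-> (forall u, u \in U -> b v u = 0).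
Proof.
move=> b_lin b_sym.
have linE u w : linfun (fun v => b v u : R^o) w = b w u.
  have lin_u : linear (fun v => b v u : R^o).
    by move=> a x y; rewrite ![b _ u]b_sym b_lin.
  pose f : {linear 'rV[R]_m -> R^o} := HB.pack (fun v => b v u : R^o)
    (GRing.isLinear.Build R 'rV[R]_m R^o *:%R (fun v => b v u : R^o) lin_u).
  exact: (lfunE f).
split=> [vU u uU|vU]; last first.
  rewrite /orthov memvE; apply/subv_bigcapP => i _.
  rewrite -memvE memv_ker linE vU //.
  by apply: vbasis_mem; rewrite mem_nth ?size_tuple.
have bv (i : 'I_(\dim U)) : b v (vbasis U)`_i = 0.
  move: vU; rewrite /orthov memvE => /subv_bigcapP/(_ i isT).
  by rewrite -memvE memv_ker linE => /eqP.
have b_sum (k : nat) (a : 'I_k -> R) (e : 'I_k -> 'rV[R]_m) :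
    b v (\sum_(i < k) a i *: e i) = \sum_(i < k) a i * b v (e i).
  elim/big_ind2: _ => [|x1 x2 y1 y2 <- <-|i _].
  - by have := b_lin v (-1) 0 0; rewrite scaler0 addr0 scaleN1r addNr.
  - by have := b_lin v 1 x2 y2; rewrite !scale1r.
  - have b0 : b v 0 = 0.
      by have := b_lin v (-1) 0 0; rewrite scaler0 addr0 scaleN1r addNr.
    by have := b_lin v (a i) (e i) 0; rewrite b0 !addr0.
rewrite (coord_vbasis uU) b_sum big1 // => i _.
by rewrite bv mulr0.
Qed.

End Forms.

Section Geometry.
Context {m : nat} {M : manifold R m}.
Implicit Types (X Y Z : field M) (f : M -> R).

Definition metric_tensor := M -> 'rV[R]_m -> 'rV[R]_m -> R.
Definition connection := field M -> field M -> field M.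

Definition semi_riemannian (g : metric_tensor) (q : nat) : Prop :=
  [/\ forall p u, linear (g p u : _ -> R^o) /\ forall v, g p u v = g p v u,
      forall p u, (forall v, g p u v = 0) -> u = 0,
      forall X Y, smooth_field X -> smooth_field Y ->
        smooth_fun setT (fun p => g p (X p) (Y p) : R^o) &
      forall p, has_index (g p) q].

(* Only the values of a connection on smooth vector fields are relevant. *)
Definition affine_connection (nabla : connection) : Prop :=
  [/\ forall X Y, smooth_field X -> smooth_field Y -> smooth_field (nabla X Y),
      forall X Y Z f, smooth_field X -> smooth_field Y -> smooth_field Z ->
        smooth_fun setT (f : M -> R^o) ->
        forall p, nabla (fun x => f x *: X x + Y x) Z p =
                  f p *: nabla X Z p + nabla Y Z p,
      forall X Y Z, smooth_field X -> smooth_field Y -> smooth_field Z ->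
        forall p, nabla X (fun x => Y x + Z x) p = nabla X Y p + nabla X Z p &
      forall X Y f, smooth_field X -> smooth_field Y ->
        smooth_fun setT (f : M -> R^o) ->
        forall p, nabla X (fun x => f x *: Y x) p =
                  dirder (f : M -> R^o) p (X p) *: Y p + f p *: nabla X Y p].

Definition fderiv X f : M -> R := fun p => dirder (f : M -> R^o) p (X p).

(* nabla_X Y - nabla_Y X = [X, Y], both sides being applied to functions. *)
Definition torsion_free (nabla : connection) : Prop :=
  forall X Y f, smooth_field X -> smooth_field Y ->
    smooth_fun setT (f : M -> R^o) ->
    forall p, fderiv (fun x => nabla X Y x - nabla Y X x) f p =
              fderiv X (fderiv Y f) p - fderiv Y (fderiv X f) p.

(* [nabla_metric g nabla X Y Z] is (nabla_X g)(Y, Z). *)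
Definition nabla_metric (g : metric_tensor) (nabla : connection) X Y Z : M -> R :=
  fun p => fderiv X (fun x => g x (Y x) (Z x)) p
           - g p (nabla X Y p) (Z p) - g p (Y p) (nabla X Z p).

Definition dual_connections (g : metric_tensor) (nabla nablas : connection)
    : Prop :=
  forall X Y Z, smooth_field X -> smooth_field Y -> smooth_field Z ->
    forall p, fderiv X (fun x => g x (Y x) (Z x)) p =
              g p (nabla X Y p) (Z p) + g p (Y p) (nablas X Z p).

(* For a statistical structure this is the Levi-Civita connection. *)
Definition mean_connection (nabla nablas : connection) : connection :=
  fun X Y p => 2^-1 *: (nabla X Y p + nablas X Y p).

Definition statistical_structure (g : metric_tensor) (q : nat)
    (nabla nablas : connection) : Prop :=
  [/\ semi_riemannian g q,
      affine_connection nabla /\ affine_connection nablas,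
      torsion_free nabla,
      forall X Y Z, smooth_field X -> smooth_field Y -> smooth_field Z ->
        forall p, nabla_metric g nabla X Y Z p = nabla_metric g nabla Y X Z p &
      dual_connections g nabla nablas].

Definition almost_contact_metric (g : metric_tensor)
    (phi : M -> 'End('rV[R]_m)) (nu : field M) (eta : M -> 'Hom('rV[R]_m, R^o))
    : Prop :=
  [/\ [/\ smooth_field nu,
          forall X, smooth_field X -> smooth_field (fun p => phi p (X p)) &
          forall X, smooth_field X -> smooth_fun setT (fun p => eta p (X p))],
      forall p u v, g p (phi p u) (phi p v) = g p u v - eta p u * eta p v,
      forall p, g p (nu p) (nu p) = 1,
      forall p u, phi p (phi p u) = - u + eta p u *: nu p &
      forall p u v, g p u (nu p) = eta p u /\
                    g p (phi p u) v + g p u (phi p v) = 0].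

Definition kenmotsu_statistical (g : metric_tensor) (q : nat)
    (nabla nablas : connection) (phi : M -> 'End('rV[R]_m)) (nu : field M)
    (eta : M -> 'Hom('rV[R]_m, R^o)) : Prop :=
  let lc := mean_connection nabla nablas in
  let K X Y p := nabla X Y p - lc X Y p in
  [/\ statistical_structure g q nabla nablas,
      almost_contact_metric g phi nu eta,
      forall X Y, smooth_field X -> smooth_field Y ->
        forall p, lc X (fun x => phi x (Y x)) p - phi p (lc X Y p) =
                  eta p (Y p) *: phi p (X p) - g p (phi p (X p)) (Y p) *: nu p,
      forall X, smooth_field X ->
        forall p, lc X nu p = - X p + eta p (X p) *: nu p &
      forall X Y, smooth_field X -> smooth_field Y ->
        forall p, K X (fun x => phi x (Y x)) p = - phi p (K X Y p)].

End Geometry.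

Arguments metric_tensor {m} M.
Arguments connection {m} M.

(* All the bundles over an immersed submanifold [iota : M -> N] are subbundles
   of the pull-back of TN; TM is identified with its image by the tangent map
   of [iota], and a vector field on M with a section of that image. *)
Section Submanifolds.
Context {m n : nat} {M : manifold R m} {N : manifold R n}.
Variables (iota : M -> N) (g : metric_tensor N).
Implicit Types E S St L D Dperp : M -> {vspace 'rV[R]_n}.

Definition tangent_bundle (p : M) : {vspace 'rV[R]_n} :=
  (linfun (tangent_map iota p) @: fullv)%VS.

Definition normal_bundle (p : M) : {vspace 'rV[R]_n} :=
  orthov (g (iota p)) (tangent_bundle p).

Definition radical (p : M) : {vspace 'rV[R]_n} :=
  (tangent_bundle p :&: normal_bundle p)%VS.

Definition complement_in (A B C : M -> {vspace 'rV[R]_n}) : Prop :=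
  forall p, (A p + B p = C p)%VS /\ (A p :&: B p = 0)%VS.

Definition lightlike_transversal (r : nat) S St L : Prop :=
  forall p, exists (U : set M) (xi nl : 'I_r -> M -> 'rV[R]_n),
    [/\ open U, U p,
        forall i, smooth_along iota U (xi i) /\ smooth_along iota U (nl i) &
        forall x, U x ->
          [/\ radical x = <<[seq xi i x | i : 'I_r]>>%VS,
              L x = <<[seq nl i x | i : 'I_r]>>%VS,
              forall i, nl i x \in (orthov (g (iota x)) (S x) :&:
                                     orthov (g (iota x)) (St x))%VS,
              forall i j, g (iota x) (xi i x) (nl j x) = (i == j)%:R &
              forall i j, g (iota x) (nl i x) (nl j x) = 0]].

(* [S], [St] and [L] are S(TM), S(TM^perp) and ltr(TM). *)
Definition lightlike_submanifold (r : nat) S St L : Prop :=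
  [/\ immersion iota,
      (0 < r)%N /\ subbundle_rank iota r radical,
      subbundle iota S /\ complement_in radical S tangent_bundle,
      subbundle iota St /\ complement_in radical St normal_bundle &
      lightlike_transversal r S St L].

Definition contact_SCR (phi : N -> 'End('rV[R]_n)) (nu : field N)
    S St D Dperp : Prop :=
  [/\ (exists2 k, (0 < k)%N & subbundle_rank iota k D) /\
      (exists2 k, (0 < k)%N & subbundle_rank iota k Dperp),
      forall p, nu (iota p) \in tangent_bundle p,
      forall p,
        [/\ S p = (D p + Dperp p + <[nu (iota p)]>)%VS,
            directv (D p + Dperp p + <[nu (iota p)]>)%VS,
            orthogonal_spaces (g (iota p)) (D p) (Dperp p),
            orthogonal_spaces (g (iota p)) (D p) <[nu (iota p)]>%VS &
            orthogonal_spaces (g (iota p)) (Dperp p) <[nu (iota p)]>%VS],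
      forall p,
        [/\ (phi (iota p) @: Dperp p <= St p)%VS,
            (D p :&: Dperp p = 0)%VS &
            Dperp p =
            (S p :&: orthov (g (iota p)) (D p + <[nu (iota p)]>))%VS] &
      forall p, (phi (iota p) @: D p <= D p)%VS /\
                (phi (iota p) @: radical p <= radical p)%VS].

(* The value at [p] of nabla_X V, where [nabla] is pulled back to a connection
   on the pull-back of TN, for [X] tangent to M and [V] a section of that
   pull-back: if V = \sum_i f_i (Z_i o iota) near p, where the Z_i are vector
   fields on N and the f_i functions on M, it is
   \sum_i (X(f_i) Z_i + f_i nabla_X Z_i). *)
Definition pullback_value (nabla : connection N) (X V : M -> 'rV[R]_n) (p : M)
    (w : 'rV[R]_n) : Prop :=
  exists (x : 'rV[R]_m) (X' : field N) (U : set M) (k : nat)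
         (f : 'I_k -> M -> R) (Z : 'I_k -> field N),
    [/\ tangent_map iota p x = X p /\ X' (iota p) = X p,
        smooth_field X' /\ (forall i, smooth_field (Z i)),
        [/\ open U, U p & forall i, smooth_fun U (f i : M -> R^o)],
        forall y, U y -> V y = \sum_(i < k) f i y *: Z i (iota y) &
        w = \sum_(i < k) (dirder (f i : M -> R^o) p x *: Z i (iota p) +
                          f i p *: nabla X' (Z i) (iota p))].

Definition pullback_connection (nabla : connection N) (X V : M -> 'rV[R]_n)
    (p : M) : 'rV[R]_n :=
  get (pullback_value nabla X V p).

(* The TM-component with respect to TM (+) tr(TM), where
   tr(TM) = ltr(TM) + S(TM^perp). *)
Definition induced_connection (nabla : connection N) St L
    (X Y : M -> 'rV[R]_n) (p : M) : 'rV[R]_n :=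
  daddv_pi (tangent_bundle p) (L p + St p)%VS (pullback_connection nabla X Y p).

Definition totally_geodesic (nabla : connection N) St L E : Prop :=
  forall X Y, is_section iota E X -> is_section iota E Y ->
    is_section iota E (induced_connection nabla St L X Y).

End Submanifolds.
End Manifolds.

Arguments metric_tensor {R m} M.
Arguments connection {R m} M.

(* Main.v *)
Require Import Defs.
From HB Require Import structures.
From mathcomp Require Import all_boot all_order all_algebra.
From mathcomp Require Import all_classical all_reals all_analysis.
From mathcomp Require Import ring lra zify.

Set Implicit Arguments.
Unset Strict Implicit.
Unset Printing Implicit Defensive.

Import Order.TTheory GRing.Theory Num.Theory.
Import numFieldNormedType.Exports.

Local Open Scope classical_set_scope.
Local Open Scope ring_scope.

(** Let a distribution E on M be orthogonal to the structure field nu, and let X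
    and Y be sections of E. The Levi-Civita connection of the ambient manifold
    is metric and satisfies nabla_X nu = - X + eta(X) nu, so differentiating
    g(Y, nu) = 0 along X gives
      g(nabla_X Y, nu) = - g(Y, nabla_X nu) = g(X, Y).
    Both ltr(TM) and S(TM^perp) are orthogonal to nu, which is a section of
    S(TM); hence the TM-component of nabla_X Y has the same product with nu
    ([induced_connection_nu]). If E defined a totally geodesic foliation, that
    component would lie in E and be orthogonal to nu, and g would vanish on E.
    But D and D^perp, being nonzero summands of an orthogonal decomposition of
    S(TM), on which g is nondegenerate, are themselves nondegenerate
    ([screen_part_nondegenerate]); so neither D^perp nor a distribution
    orthogonal to nu that contains D can be totally geodesic
    ([not_totally_geodesic]).

    Two points need preparation. The argument is about a point p and two vectors
    of D or D^perp at p, and these have to be extended to global sections; and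
    the connection pulled back to M is characterized by expressions of sections
    in terms of global ambient fields, which have to be shown to exist. Both rest
    on smooth bump functions ([exists_bump_rV], [exists_bump]), which give
    [section_through] and [pullback_value_exists]. Only the existence of such an
    expression matters: the product of its value with nu is computed in
    [pullback_connection_metric] from an arbitrary expression, by the chain rule
    and the Leibniz rule. Finally, the projection onto TM behaves as expected
    because T(Mbar) = TM (+) ltr(TM) (+) S(TM^perp), which is a dimension count
    ([transversal_decomposition]). *)

(** * Calculus of the classes C^k on open sets of R^m *)

Section DiffLocal.
Context {R : realType} {V W : normedModType R}.

(** The differential is a germ: this is what makes the classes C^k local. *)
Lemma near_eq_diff_and_differentiable (f h : V -> W) (a : V) :
    {near a, f =1 h} -> differentiable f a ->
  differentiable h a /\ 'd h a = 'd f a :> (V -> W).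
Proof.
move=> fh df.
have E : h \o shift a = cst (h a) + 'd f a +o_ 0 id.
  apply/eqaddoP => _/posnumP[e].
  have /eqaddoP/(_ _ (gt0 e)) := diff_locally df.
  move=> E1.
  have E2 : \forall x \near (0 : V), f (x + a) = h (x + a).
    by move: fh; rewrite (near_shift 0) subr0; apply: filterS => x.
  near=> x.
  have E3 : (h \o shift a - (cst (h a) + 'd f a)) x =
            (f \o shift a - (cst (f a) + 'd f a)) x.
    rewrite !fctE /= (nbhs_singleton fh); congr (_ - _).
    by apply/esym; near: x; exact: E2.
  by rewrite E3; near: x; exact: E1.
have dh : 'd h a = 'd f a :> (V -> W).
  by apply: diff_unique => //; exact: diff_continuous.
split => //; apply/diff_locallyP; rewrite dh; split => //.
exact: diff_continuous.
Unshelve. all: by end_near. Qed.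

Lemma near_eq_differentiable (f h : V -> W) (a : V) :
  {near a, f =1 h} -> differentiable f a -> differentiable h a.
Proof. by move=> fh /(near_eq_diff_and_differentiable fh)[]. Qed.

Lemma near_eq_diff (f h : V -> W) (a : V) :
  {near a, f =1 h} -> differentiable f a -> 'd h a = 'd f a :> (V -> W).
Proof. by move=> fh /(near_eq_diff_and_differentiable fh)[]. Qed.

Lemma scale_is_bilinear :
  bilinear_for
    (GRing.Scale.Law.clone _ _ *:%R _) (GRing.Scale.Law.clone _ _ *:%R _)
    (@GRing.scale R W : R^o -> W -> W).
Proof.
split=> [u'|u] a x y /=; first by rewrite scalerDl scalerA.
by rewrite scalerDr !scalerA mulrC.
Qed.

Let scaleb : {bilinear R^o -> W -> W} :=
  HB.pack (@GRing.scale R W : R^o -> W -> W)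
    (bilinear_isBilinear.Build R R^o W W _ _ _ scale_is_bilinear).

(** Leibniz rule for a scalar function times a vector-valued one, as the chain
    rule for the bilinear map (a, w) |-> a *: w. *)
Lemma scale_diff (f : V -> R^o) (F : V -> W) (a : V) :
    differentiable f a -> differentiable F a ->
  differentiable (fun x => f x *: F x) a /\
  'd (fun x => f x *: F x) a = (fun v => 'd f a v *: F a + f a *: 'd F a v)
    :> (V -> W).
Proof.
move=> df dF.
have sc : continuous (fun p : R^o * W => scaleb p.1 p.2) by exact: scale_continuous.
have dp := differentiable_pair df dF.
have ds := differentiable_bilin (f a, F a) sc.
split; first exact: (differentiable_comp dp ds).
have := diff_comp dp ds; rewrite (diff_bilin _ sc) diff_pair //= => E.
rewrite -[LHS]/(_ : V -> W) [LHS]E.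
by apply/funext => v /=; rewrite addrC.
Qed.

End DiffLocal.

Section ClassC.
Context {R : realType} {m : nat}.
Implicit Types (k : nat) (U V : set 'rV[R]_m).

Lemma class_C_sub (W : normedModType R) k U V (f : 'rV[R]_m -> W) :
  V `<=` U -> class_C k U f -> class_C k V f.
Proof.
move=> VU; elim: k f => [|k IH] f /=; first by move=> H x /VU; exact: H.
by case=> df H; split=> [x /VU|v]; [exact: df|exact: IH].
Qed.

Lemma class_C_local (W : normedModType R) k U (f : 'rV[R]_m -> W) :
  (forall x, U x -> exists2 V, V x & class_C k V f) -> class_C k U f.
Proof.
elim: k f => [|k IH] f /= H; first by move=> x /H[V Vx]; exact.
split=> [x /H[V Vx [+ _]]|v]; first exact.
by apply: IH => x /H[V Vx [_ H1]]; exists V.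
Qed.

Lemma class_C_eq (W : normedModType R) k U (f h : 'rV[R]_m -> W) :
  open U -> {in U, f =1 h} -> class_C k U f -> class_C k U h.
Proof.
move=> oU; have near_U x F : U x -> (forall y, U y -> F y) -> \near x, F x.
  by move=> Ux UF; apply: filterS (open_nbhs_nbhs (conj oU Ux)).
have near_eq f' h' x : {in U, f' =1 h'} -> U x -> {near x, f' =1 h'}.
  move=> fh' Ux; apply: (near_U x (fun y => f' y = h' y)) => // y Uy.
  by apply: fh'; exact: mem_set.
elim: k f h => [|k IH] f h fh.
  move=> H x Ux; have := H _ Ux.
  rewrite /prop_for /continuous_at -(fh _ (mem_set Ux)); apply: cvg_trans.
  by apply: (@near_eq_cvg _ _ (nbhs x) _ f h); exact: near_eq fh Ux.
case=> df H; split=> [x Ux|v].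
  by apply: near_eq_differentiable (df _ Ux); exact: near_eq.
apply: IH (H v) => x /set_mem Ux.
exact/esym/(congr1 (@^~ v) (near_eq_diff (near_eq _ _ _ _ fh Ux) (df _ Ux))).
Qed.

Lemma class_C_mono (W : normedModType R) k U (f : 'rV[R]_m -> W) :
  class_C k.+1 U f -> class_C k U f.
Proof.
elim: k f => [|k IH] f [df H].
  by move=> x Ux; apply/differentiable_continuous/df.
by split => // v; exact: IH.
Qed.

Lemma class_C_cst (W : normedModType R) k U (w : W) :
  class_C k U (fun=> w).
Proof.
elim: k w => [|k IH] w; first by move=> x _; exact: cst_continuous.
split=> [x _|v]; first exact: differentiable_cst.
rewrite (_ : (fun x => _) = fun=> 0) //.
by apply/funext => x; rewrite diff_cst.
Qed.

Lemma class_C_add (W : normedModType R) k U (f h : 'rV[R]_m -> W) :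
  open U -> class_C k U f -> class_C k U h -> class_C k U (fun x => f x + h x).
Proof.
move=> oU; elim: k f h => [|k IH] f h.
  by move=> cf ch x Ux; apply: continuousD; [exact: cf|exact: ch].
case=> df Hf [dh Hh]; split=> [x Ux|v].
  by apply: differentiableD; [exact: df|exact: dh].
apply: class_C_eq (IH _ _ (Hf v) (Hh v)) => // x /set_mem Ux.
exact/esym/(congr1 (@^~ v) (diffD (df _ Ux) (dh _ Ux))).
Qed.

Lemma class_C_sum (W : normedModType R) k U (I : Type) (s : seq I)
    (f : I -> 'rV[R]_m -> W) :
  open U -> (forall i, class_C k U (f i)) ->
  class_C k U (fun x => \sum_(i <- s) f i x).
Proof.
move=> oU H; elim: s => [|i s IH].
  apply: class_C_eq (class_C_cst k U 0) => // x _.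
  by rewrite big_nil.
by apply: class_C_eq (class_C_add oU (H i) IH) => // x _; rewrite big_cons.
Qed.

Lemma class_C_scale (W : normedModType R) k U (f : 'rV[R]_m -> R^o)
    (F : 'rV[R]_m -> W) :
  open U -> class_C k U f -> class_C k U F ->
  class_C k U (fun x => f x *: F x).
Proof.
move=> oU; elim: k f F => [|k IH] f F.
  by move=> cf cF x Ux; apply: continuousZ; [exact: cf|exact: cF].
move=> Cf CF; have [[df Hf] [dF HF]] := (Cf, CF); split=> [x Ux|v].
  by have [] := scale_diff (df _ Ux) (dF _ Ux).
apply: (@class_C_eq _ _ _ (fun x => 'd f x v *: F x + f x *: 'd F x v)) => //.
  move=> x /set_mem Ux; have [_ E] := scale_diff (df _ Ux) (dF _ Ux).
  exact/esym/(congr1 (@^~ v) E).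
apply: class_C_add => //; apply: IH.
- exact: Hf.
- exact: class_C_mono CF.
- exact: class_C_mono Cf.
- exact: HF.
Qed.

Lemma class_C_linear (W W' : normedModType R) (L : {linear W -> W'}) k U
    (f : 'rV[R]_m -> W) :
  open U -> continuous L -> class_C k U f -> class_C k U (fun x => L (f x)).
Proof.
move=> oU cL; elim: k f => [|k IH] f.
  by move=> cf x Ux; apply: continuous_comp; [exact: cf|exact: cL].
have dL y := @linear_differentiable _ _ _ L y cL.
case=> df Hf; split=> [x Ux|v].
  exact: (differentiable_comp (df _ Ux) (dL _)).
apply: class_C_eq (IH _ (Hf v)) => // x /set_mem Ux.
rewrite -/(L \o f) (diff_comp (df _ Ux) (dL _)) /=.
by rewrite (diff_lin _ cL).
Qed.

Lemma class_C_coord (n k : nat) U (f : 'rV[R]_m -> 'rV[R]_n) (j : 'I_n) :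
  open U -> class_C k U f -> class_C k U (fun x => f x 0 j : R^o).
Proof.
move=> oU Cf.
have @L : {linear 'rV[R]_n -> R^o}.
  by exists (fun N : 'rV[R]_n => N 0 j); do 2![eexists]; do ?[constructor];
     rewrite ?mxE// => ? *; rewrite ?mxE//; move=> ?; rewrite !mxE.
by apply: (@class_C_linear _ _ L) => //; exact: coord_continuous.
Qed.

Lemma class_C_id k U : class_C k U (fun x => x).
Proof.
case: k => [|k]; first by move=> x _; exact: cvg_id.
split=> [x _|v]; first exact: ex_diff.
rewrite (_ : (fun x => _) = fun=> v); first exact: class_C_cst.
by apply/funext => x; rewrite (@diff_val _ _ _ _ _ id id _).
Qed.

Lemma class_C_inv k U (f : 'rV[R]_m -> R^o) :
  open U -> (forall x, U x -> f x != 0) -> class_C k U f ->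
  class_C k U (fun x => (f x)^-1 : R^o).
Proof.
move=> oU f0; elim: k => [|k IH].
  by move=> cf x Ux; apply: continuousV; [exact: f0|exact: cf].
move=> Cf; have Cif := IH (class_C_mono Cf); case: Cf => df Hf; split=> [x Ux|v].
  by apply: differentiableV; [exact: df|exact: f0].
apply: (@class_C_eq _ _ _ (fun x =>
    (-1 : R^o) *: ((f x)^-1 *: ((f x)^-1 *: ('d f x v : R^o))))) => //.
  move=> x /set_mem Ux; have E := diffV (df _ Ux) (f0 _ Ux).
  apply: etrans (esym (congr1 (@^~ v) E)).
  rewrite !scaleN1r !scalerA -invfM -expr2.
  exact: (esym (scaleNr _ _)).
apply: class_C_scale => //; first exact: class_C_cst.
apply: class_C_scale => //; apply: class_C_scale => //; exact: Hf.
Qed.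

End ClassC.

(** The differential of a composite applied to v is the sum over j of the j-th
    component of 'd f x v times the partial derivative of h in direction j at
    f x; so products of functions to which the induction on k applies. *)
Lemma class_C_comp (R : realType) (m n k : nat) (W : normedModType R)
    (U : set 'rV[R]_m) (V : set 'rV[R]_n)
    (f : 'rV[R]_m -> 'rV[R]_n) (h : 'rV[R]_n -> W) :
  open U -> (forall x, U x -> V (f x)) -> class_C k U f -> class_C k V h ->
  class_C k U (fun x => h (f x)).
Proof.
move=> oU UV; elim: k h => [|k IH] h.
  move=> cf ch x Ux; apply: continuous_comp; first exact: cf.
  exact/ch/UV.
move=> Cf; have Cf' := class_C_mono Cf; case: Cf => df Hf [dh Hh].
split=> [x Ux|v].
  by apply: differentiable_comp; [exact: df|exact/dh/UV].
apply: (@class_C_eq _ _ _ _ _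
  (fun x => \sum_(j < n) ('d f x v 0 j : R^o) *: 'd h (f x) (delta_mx 0 j))) => //.
  move=> x /set_mem Ux.
  rewrite -/(h \o f) (diff_comp (df _ Ux) (dh _ (UV _ Ux))) /=.
  rewrite [in RHS](row_sum_delta ('d f x v)) linear_sum.
  by apply: eq_bigr => j _; rewrite linearZ.
apply: class_C_sum => // j; apply: class_C_scale => //.
  exact: (class_C_coord _ oU (Hf v)).
exact: (IH (fun y => 'd h y (delta_mx 0 j)) Cf' (Hh _)).
Qed.

(** * Bump functions on R^m *)

Section Bump.
Context {R : realType}.
Implicit Types (P : {poly R}) (t : R).

(** For the constant polynomial 1 this is the usual smooth function that is
    exp(-1/t) for t > 0 and 0 elsewhere. The polynomial factor makes the family
    stable under derivation, so that smoothness is a single induction. *)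
Definition flat P t : R := if 0 < t then P.[t^-1] * expR (- t^-1) else 0.

(** With s = 1/t, the derivative of P(s) exp(-s) with respect to t is
    s^2 (P(s) - P'(s)) exp(-s). *)
Definition flat_deriv P : {poly R} := 'X^2 * (P - P^`()).

(** Monomial by monomial, from s^i <= i! exp(s). *)
Lemma exp_dominates_poly P :
  exists2 C, 0 <= C & forall s, 0 <= s -> `|P.[s]| * expR (- s) <= C.
Proof.
exists (\sum_(i < size P) `|P`_i| * i`!%:R).
  by apply: sumr_ge0 => i _; rewrite mulr_ge0.
move=> s s0; rewrite horner_coef.
apply: (@le_trans _ _ ((\sum_(i < size P) `|P`_i| * s ^+ i) * expR (- s))).
  rewrite ler_wpM2r ?expR_ge0// (le_trans (ler_norm_sum _ _ _))//.
  by apply: ler_sum => i _; rewrite normrM (ger0_norm (exprn_ge0 _ s0)).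
rewrite mulr_suml; apply: ler_sum => i _; rewrite -mulrA ler_wpM2l//.
rewrite expRN ler_pdivrMr ?expR_gt0//.
case: (i : nat) => [|j]; first by rewrite expr0 fact0 mul1r -expR0 ler_expR.
rewrite mulrC -ler_pdivrMr ?ltr0n ?fact_gt0//.
by apply: le_trans (expR_ge1Dxn j s0); rewrite lerDr.
Qed.

(** Quadratic decay at 0 makes the derivative at 0 exist and vanish. *)
Lemma flat_le_sqr P : exists2 C, 0 <= C & forall t, `|flat P t| <= C * t ^+ 2.
Proof.
have [C C0 H] := exp_dominates_poly ('X^2 * P); exists C => // t.
rewrite /flat; case: ifPn => [t0|_]; last by rewrite normr0 mulr_ge0 ?sqr_ge0.
have := H t^-1; rewrite invr_ge0 (ltW t0) => /(_ isT).
rewrite hornerM hornerXn !normrM (ger0_norm (expR_ge0 _)) -mulrA.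
rewrite ger0_norm ?exprn_ge0 ?invr_ge0 ?(ltW t0)//.
move=> K; rewrite -ler_pdivrMr ?exprn_gt0//; apply: le_trans K.
by rewrite expr2 invfM mulrC -!mulrA.
Qed.

Lemma is_derive_flat P t : is_derive t 1 (flat P) (flat (flat_deriv P) t).
Proof.
have [t0|t0|<-] := ltgtP 0 t.
- pose F : R -> R := fun x => P.[x^-1] * expR (- x^-1).
  apply: (@near_eq_is_derive _ _ _ F).
    near=> x; rewrite /flat ifT//; near: x.
    by apply: open_nbhs_nbhs; split => //; exact: open_gt.
  have dV : is_derive t 1 (@GRing.inv R) (- t ^- 2 *: 1).
    by apply: is_deriveV => //; rewrite gt_eqF.
  have dP : is_derive t 1 (horner P \o @GRing.inv R) (- t ^- 2 *: 1 * (P^`()).[t^-1]).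
    rewrite mulrC.
    by apply: is_derive1_comp.
  have dE : is_derive t 1 (expR \o (- @GRing.inv R)) (- (- t ^- 2 *: 1) * expR (- t^-1)).
    rewrite mulrC.
    by apply: is_derive1_comp.
  apply: is_derive_eq.
  rewrite /flat t0 /flat_deriv /= !hornerE /= /GRing.scale /= !mulr1.
  by rewrite exprVn; ring.
- rewrite /flat ltNge ltW//=.
  apply: (@near_eq_is_derive _ _ _ (cst 0)).
    near=> x; rewrite /flat ifF//; apply/negP/negP; rewrite -leNgt ltW//; near: x.
    by apply: open_nbhs_nbhs; split => //; exact: open_lt.
(* the difference quotient at 0 is bounded by C |h| *)
- have [C C0 H] := flat_le_sqr P.
  have F0 Q : flat Q 0 = 0 by rewrite /flat ltxx.
  have cv : h^-1 *: (flat P (h *: 1 + 0) - flat P 0) @[h --> 0^'] --> (0 : R).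
    apply/cvgrPdist_le => e e0; near=> h.
    rewrite F0 subr0 sub0r normrN addr0 normrM normfV.
    have h0 : h != 0 by near: h; exact: nbhs_dnbhs_neq.
    rewrite mulrC ler_pdivrMr ?normr_gt0// (le_trans (H _))//.
    rewrite [h%:A]mulr1 -[h ^+ 2]ger0_norm ?sqr_ge0// normrX expr2 mulrA ler_wpM2r//.
    have hC : `|h| <= e / (C + 1).
      by near: h; apply: dnbhs0_le; rewrite divr_gt0// ltr_wpDl.
    apply: (@le_trans _ _ ((C + 1) * `|h|)); first by rewrite ler_wpM2r// lerDl.
    by rewrite mulrC -ler_pdivlMr// ltr_wpDl.
  rewrite F0; apply: DeriveDef; first by apply/cvg_ex; exists 0.
  exact: cvg_lim.
Unshelve. all: by end_near. Qed.

Lemma class_C_comp_flat m k (U : set 'rV[R]_m) P (h : 'rV[R]_m -> R^o) :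
  open U -> class_C k U h -> class_C k U (fun x => flat P (h x) : R^o).
Proof.
have dfl Q t : differentiable (flat Q : R^o -> R^o) t.
  by apply/derivable1_diffP; have [] := is_derive_flat Q t.
move=> oU; elim: k P => [|k IH] P.
  move=> ch x Ux; apply: continuous_comp; first exact: ch.
  exact: differentiable_continuous.
move=> Ch; have Ch' := class_C_mono Ch; case: Ch => dh Hh; split=> [x Ux|v].
  by apply: differentiable_comp => //; exact: dh.
apply: (@class_C_eq _ _ _ _ _
  (fun x => (flat (flat_deriv P) (h x) : R^o) *: ('d h x v : R^o))) => //.
  move=> x /set_mem Ux.
  have E := diff_comp (dh _ Ux) (dfl P (h x)).
  apply: etrans (esym (congr1 (@^~ v) E)) => /=.
  have dP := is_derive_flat P (h x).
  rewrite (deriv1E (@ex_derive _ _ _ _ _ _ _ dP)) derive1E derive_val.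
  exact: mulrC.
by apply: class_C_scale => //; [exact: IH|exact: Hh].
Qed.

Lemma flat1_gt0 t : (0 < flat 1 t) = (0 < t).
Proof.
by rewrite /flat; case: ifP; rewrite ?ltxx// hornerC mul1r expR_gt0.
Qed.

Lemma flat1_ge0 t : 0 <= flat 1 t.
Proof.
by rewrite /flat; case: ifP => // _; rewrite hornerC mul1r expR_ge0.
Qed.

(** With rho the squared Euclidean distance to a, c2 = e^2 and c1 = e^2 / 2, the
    quotient psi(c2 - rho) / (psi(c2 - rho) + psi(rho - c1)), where psi is the
    function exp(-1/t) extended by 0, is 1 where rho < c1 and 0 where
    rho >= c2. Balls are those of the sup norm, which is at most the Euclidean
    norm. *)
Lemma exists_bump_rV m (a : 'rV[R]_m) (e : R) : 0 < e ->
  exists b : 'rV[R]_m -> R^o,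
    [/\ class_Coo setT b, \forall x \near a, b x = 1 &
        forall x, ~ ball a e x -> b x = 0].
Proof.
move=> e0; pose rho (x : 'rV[R]_m) : R^o :=
  \sum_(j < m) (x 0 j - a 0 j : R^o) *: (x 0 j - a 0 j : R^o).
have Crho k : class_C k setT rho.
  apply: class_C_sum; first exact: openT.
  move=> j; have Cj : class_C k setT (fun x : 'rV[R]_m => x 0 j - a 0 j : R^o).
    apply: class_C_add; first exact: openT.
      apply: class_C_coord; [exact: openT|exact: class_C_id].
    exact: class_C_cst.
  by apply: class_C_scale => //; exact: openT.
pose c2 := e ^+ 2; pose c1 := c2 / 2.
have c2_gt0 : 0 < c2 by rewrite exprn_gt0.
have c12 : c1 < c2 by rewrite ltr_pdivrMr// ltr_pMr// ltr1n.
pose N x : R^o := flat 1 (c2 - rho x); pose O x : R^o := flat 1 (rho x - c1).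
have CN k : class_C k setT N.
  apply: class_C_comp_flat; first exact: openT.
  apply: (@class_C_add _ _ _ _ _ (fun=> c2) (fun x => - rho x)); first exact: openT.
    exact: class_C_cst.
  apply: (@class_C_eq _ _ _ _ _ (fun x => (-1 : R^o) *: rho x)); first exact: openT.
    by move=> x _; rewrite scaleN1r.
  by apply: class_C_scale; [exact: openT|exact: class_C_cst|].
have CO k : class_C k setT O.
  apply: class_C_comp_flat; first exact: openT.
  by apply: class_C_add => //; [exact: openT|exact: class_C_cst].
(* one of the two summands is positive because c1 < c2 *)
have NO x : 0 < N x + O x.
  have [r|r] := ltP (rho x) c2.
    by rewrite ltr_wpDr ?flat1_ge0// flat1_gt0 subr_gt0.
  rewrite ltr_wpDl ?flat1_ge0// flat1_gt0 subr_gt0.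
  exact: lt_le_trans r.
exists (fun x => (N x + O x)^-1 *: N x); split.
- move=> k; apply: class_C_scale => //; first exact: openT.
  apply: class_C_inv; first exact: openT.
    by move=> x _; rewrite gt_eqF.
  by apply: class_C_add => //; exact: openT.
- have rho0 : rho a = 0 by rewrite /rho big1// => j _; rewrite subrr scale0r.
  have crho : {for a, continuous rho} by exact: (Crho 0%N).
  have : \forall x \near a, rho x < c1.
    apply: (crho [set r | r < c1]); apply: open_nbhs_nbhs; split.
      exact: open_lt.
    by rewrite /= rho0 divr_gt0.
  apply: filterS => x rx.
  have -> : O x = 0 by rewrite /O /flat ifF// subr_gt0 ltNge (ltW rx).
  rewrite addr0 [LHS]mulVf// gt_eqF// flat1_gt0 subr_gt0.
  exact: lt_trans c12.
- move=> x xa; have -> : N x = 0; last by rewrite scaler0.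
  rewrite /N /flat ifF//; apply/negP; rewrite subr_gt0 => rx; apply: xa.
  split=> // i j; rewrite ord1 /ball /= ltNge; apply/negP => ej.
  suff : c2 <= rho x by rewrite leNgt rx.
  apply: (@le_trans _ _ ((x 0 j - a 0 j) ^+ 2)).
    rewrite -[leRHS]ger0_norm ?sqr_ge0// normrX -normrN opprB.
    by rewrite ler_sqr ?nnegrE ?(ltW e0).
  rewrite /rho (bigD1 j)//= lerDl.
  by apply: sumr_ge0 => k _; rewrite -[_ *: _]/(_ * _) -expr2 sqr_ge0.
Unshelve. all: by end_near. Qed.

End Bump.

(** * Smooth functions and changes of coordinates on a manifold *)

Section SmoothFunctions.
Context {R : realType} {m : nat} {M : manifold R m}.
Implicit Types (U V : set M) (c d : chart R m M).

Lemma chart_image_open c U : open U -> open (c @` (U `&` cdom c)).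
Proof.
move=> oU; rewrite openE => _ [p [Up cp] <-]; rewrite /interior.
have cip : (c @` cdom c) (c p) by exists p.
have N1 : \forall x \near c p, (c @` cdom c) x.
  by apply: open_nbhs_nbhs; split => //; exact: cimg_open.
have N2 : \forall x \near c p, U (cinv c x).
  apply: (cinv_continuous cip); rewrite cmapK//.
  by apply: open_nbhs_nbhs; split.
near=> x; have [q cq E] : (c @` cdom c) x by near: x.
have : U (cinv c x) by near: x.
by rewrite -E cmapK// => Uq; exists q.
Unshelve. all: by end_near. Qed.

Lemma smooth_fun_sub (W : normedModType R) U V (f : M -> W) :
  V `<=` U -> smooth_fun U f -> smooth_fun V f.
Proof.
move=> VU sf c ac k; apply: class_C_sub (sf c ac k).
by move=> _ [p [Vp cp] <-]; exists p => //; split => //; exact: VU.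
Qed.

(** Smoothness can be checked on sets covering U. They may be arbitrary: being
    C^k on a set is a pointwise condition on a function of the whole space. *)
Lemma smooth_fun_local (W : normedModType R) U (f : M -> W) :
  (forall p, U p -> exists2 V, V p & smooth_fun V f) -> smooth_fun U f.
Proof.
move=> H c ac k; apply: class_C_local => _ [p [Up cp] <-].
have [V Vp sf] := H p Up; exists (c @` (V `&` cdom c)); last exact: sf.
by exists p.
Qed.

Lemma smooth_fun_eq (W : normedModType R) U (f h : M -> W) :
  open U -> {in U, f =1 h} -> smooth_fun U f -> smooth_fun U h.
Proof.
move=> oU fh sf c ac k; apply: class_C_eq (sf c ac k).
  exact: chart_image_open.
by move=> _ /set_mem[p [Up cp] <-] /=; rewrite cmapK// fh// mem_set.
Qed.

Lemma smooth_fun_cst (W : normedModType R) U (w : W) : smooth_fun U (fun=> w).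
Proof. by move=> c ac k; exact: class_C_cst. Qed.

Lemma smooth_fun_sum (W : normedModType R) U (I : Type) (s : seq I)
    (f : I -> M -> W) :
  open U -> (forall i, smooth_fun U (f i)) ->
  smooth_fun U (fun p => \sum_(i <- s) f i p).
Proof.
move=> oU sf c ac k.
apply: (@class_C_sum _ _ _ k _ _ s (fun i => f i \o cinv c)).
  exact: chart_image_open.
by move=> i; exact: sf.
Qed.

Lemma smooth_fun_scale (W : normedModType R) U (a : M -> R^o) (f : M -> W) :
  open U -> smooth_fun U a -> smooth_fun U f ->
  smooth_fun U (fun p => a p *: f p).
Proof.
move=> oU sa sf c ac k.
apply: (@class_C_scale _ _ _ k _ (a \o cinv c) (f \o cinv c)).
- exact: chart_image_open.
- exact: sa.
- exact: sf.
Qed.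

Lemma smooth_fun_coord (n : nat) U (f : M -> 'rV[R]_n) (j : 'I_n) :
  open U -> smooth_fun U f -> smooth_fun U (fun p => f p 0 j : R^o).
Proof.
move=> oU sf c ac k; apply: (@class_C_coord _ _ _ k _ (f \o cinv c) j).
  exact: chart_image_open.
exact: sf.
Qed.

(** A function that is smooth when read in one chart is smooth: its expressions in
    the other charts differ by the changes of charts of the atlas. *)
Lemma smooth_fun_chart (W : normedModType R) c U (F : 'rV[R]_m -> W) :
  atlas c -> open U -> U `<=` cdom c -> class_Coo (c @` U) F ->
  smooth_fun U (F \o c).
Proof.
move=> ac oU Uc CF d ad k.
apply: (@class_C_comp _ _ _ k _ (d @` (U `&` cdom d)) (c @` U)
   (c \o cinv d) F).
- exact: chart_image_open.
- by move=> _ [p [Up dp] <-]; exists p => //=; rewrite cmapK.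
- apply: class_C_sub (atlas_compatible ad ac k).
  by move=> _ [p [Up dp] <-]; exists p => //; split => //; exact: Uc.
- exact: CF.
Qed.

Lemma smooth_fun_differentiable (W : normedModType R) c U (f : M -> W) p :
  atlas c -> cdom c p -> smooth_fun U f -> U p ->
  differentiable (f \o cinv c) (c p).
Proof.
move=> ac cp sf Up; have [+ _] := sf c ac 1%N; apply.
by exists p.
Qed.

Lemma near_chart_inv c U p :
  open U -> U p -> cdom c p -> \forall x \near c p, U (cinv c x).
Proof.
move=> oU Up cp; apply: (@cinv_continuous _ _ _ c (c p)); first by exists p.
by rewrite cmapK//; apply: open_nbhs_nbhs; split.
Qed.

Lemma dirder_eq (W : normedModType R) U (f h : M -> W) p v :
    open U -> U p -> {in U, f =1 h} -> smooth_fun U f ->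
  dirder h p v = dirder f p v.
Proof.
move=> oU Up fh sf; have dp := chart_at_dom p.
have E := @near_eq_diff _ _ _ (f \o cinv (chart_at p)) (h \o cinv (chart_at p))
  (chart_at p p).
apply: (congr1 (@^~ v) (E _ _)).
  by apply: filterS (near_chart_inv oU Up dp) => x Ux /=; rewrite fh// mem_set.
exact: smooth_fun_differentiable (chart_at_atlas p) dp sf Up.
Qed.

Lemma dirder_scale (W : normedModType R) U (a : M -> R^o) (f : M -> W) p v :
    U p -> smooth_fun U a -> smooth_fun U f ->
  dirder (fun p => a p *: f p) p v = dirder a p v *: f p + a p *: dirder f p v.
Proof.
move=> Up sa sf; have dp := chart_at_dom p.
have da := smooth_fun_differentiable (chart_at_atlas p) dp sa Up.
have df := smooth_fun_differentiable (chart_at_atlas p) dp sf Up.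
have [_ E] := scale_diff da df.
by apply: etrans (congr1 (@^~ v) E) _; rewrite /= cmapK.
Qed.

Lemma dirder_sum (W : normedModType R) U (I : Type) (s : seq I)
    (f : I -> M -> W) p v :
    open U -> U p -> (forall i, smooth_fun U (f i)) ->
  dirder (fun p => \sum_(i <- s) f i p) p v = \sum_(i <- s) dirder (f i) p v.
Proof.
move=> oU Up sf; have dp := chart_at_dom p.
have df F : smooth_fun U F -> differentiable (F \o cinv (chart_at p)) (chart_at p p).
  by move=> sF; exact: smooth_fun_differentiable (chart_at_atlas p) dp sF Up.
elim: s => [|i s IH].
  rewrite big_nil (_ : (fun p => _) = fun=> 0); last first.
    by apply/funext => q; rewrite big_nil.
  exact: (congr1 (@^~ v) (@diff_cst _ _ W 0 (chart_at p p))).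
rewrite big_cons -IH.
rewrite (_ : (fun p => _) = f i \+ (fun p => \sum_(j <- s) f j p)); last first.
  by apply/funext => q; rewrite big_cons.
have E := diffD (df _ _ (sf i)) (df _ _ (smooth_fun_sum s oU sf)).
exact: (congr1 (@^~ v) E).
Qed.

(** The components in d of the vector at p that has components v in c. *)
Definition chart_change c d p : 'rV[R]_m -> 'rV[R]_m := 'd (d \o cinv c) (c p).

Lemma chart_smooth c : atlas c -> smooth_fun (cdom c) c.
Proof.
move=> ac d ad k; apply: class_C_sub (atlas_compatible ad ac k).
by move=> _ [p [cp dp] <-]; exists p.
Qed.

(** The differential of f at p does not depend on the chart: chain rule for
    f o d^-1 and d o c^-1, whose composite is f o c^-1 near c p only. *)
Lemma diff_chart_change (W : normedModType R) (f : M -> W) U c d p v :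
    open U -> U p -> smooth_fun U f -> atlas c -> atlas d -> cdom c p -> cdom d p ->
  'd (f \o cinv d) (d p) (chart_change c d p v) = 'd (f \o cinv c) (c p) v.
Proof.
move=> oU Up sf ac ad cp dp.
have df := smooth_fun_differentiable ad dp sf Up.
have dd := smooth_fun_differentiable ac cp (chart_smooth ad) dp.
have dpE : (d \o cinv c) (c p) = d p by rewrite /= cmapK.
rewrite -dpE in df.
have E := diff_comp dd df.
rewrite /chart_change -dpE.
apply: etrans (esym (congr1 (@^~ v) E)) _.
have NE := @near_eq_diff _ _ _ ((f \o cinv d) \o (d \o cinv c)) (f \o cinv c) (c p).
apply/esym; apply: (congr1 (@^~ v) (NE _ _)).
  apply: filterS (near_chart_inv (cdom_open d) dp cp) => x dx /=.
  by rewrite cmapK.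
exact: differentiable_comp.
Qed.

Lemma chart_change_comp b c d p v :
    atlas b -> atlas c -> atlas d -> cdom b p -> cdom c p -> cdom d p ->
  chart_change c d p (chart_change b c p v) = chart_change b d p v.
Proof.
move=> ab ac ad bp cp dp.
exact: (diff_chart_change _ (cdom_open d) dp (chart_smooth ad) ab ac bp cp).
Qed.

Lemma chart_change_id c p v : cdom c p -> chart_change c c p v = v.
Proof.
move=> cp; have E := @near_eq_diff _ _ _ (id : 'rV[R]_m -> _) (c \o cinv c) (c p).
apply: etrans (congr1 (@^~ v) (E _ _)) _.
- have : \forall x \near c p, (c @` cdom c) x.
    by apply: open_nbhs_nbhs; split; [exact: cimg_open|exists p].
  by apply: filterS => _ [q cq <-] /=; rewrite cmapK.
- exact: ex_diff.
- by rewrite (@diff_val _ _ _ _ _ id id _).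
Qed.

End SmoothFunctions.

Lemma dirder_comp (R : realType) (m n : nat) (M : manifold R m)
    (N : manifold R n) (W : normedModType R) (h : M -> N) (f : N -> W)
    (U : set N) p v :
    smooth_map h -> open U -> U (h p) -> smooth_fun U f ->
  dirder (f \o h) p v = dirder f (h p) (tangent_map h p v).
Proof.
move=> [ch sh] oU Up sf.
set c := chart_at p; set d := chart_at (h p).
have ac : atlas c by exact: chart_at_atlas.
have ad : atlas d by exact: chart_at_atlas.
have cp : cdom c p by exact: chart_at_dom.
have dp : cdom d (h p) by exact: chart_at_dom.
have df := smooth_fun_differentiable ad dp sf Up.
have dh := smooth_fun_differentiable ac cp (sh d ad) dp.
have dpE : ((d \o h) \o cinv c) (c p) = d (h p) by rewrite /= cmapK.
rewrite -dpE in df.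
have E := diff_comp dh df.
rewrite /tangent_map /dirder -/c -/d -dpE.
apply: etrans (congr1 (@^~ v) E).
have NE := @near_eq_diff _ _ _ ((f \o cinv d) \o ((d \o h) \o cinv c))
  ((f \o h) \o cinv c) (c p).
apply: (congr1 (@^~ v) (NE _ _)); last exact: differentiable_comp.
have oV : open (h @^-1` cdom d) by apply: open_comp (cdom_open d) => x _; exact: ch.
apply: filterS (near_chart_inv oV dp cp) => x dx /=.
by rewrite cmapK.
Qed.

(** * Cut-offs, and existence of the pulled-back connection *)

(** A bump function read in a chart around p, extended by 0. Its support is the
    image F of a closed ball, hence compact, hence closed because M is
    Hausdorff; so the function is smooth on the open complement of F, which
    together with the domain of the chart covers M. *)
Lemma exists_bump (R : realType) (m : nat) (M : manifold R m) (U : set M) (p : M) :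
  open U -> U p -> exists b : M -> R^o,
    [/\ smooth_fun setT b,
        exists V, [/\ open V, V p & forall q, V q -> b q = 1] &
        exists F, [/\ closed F, F `<=` U & forall q, ~ F q -> b q = 0]].
Proof.
move=> oU Up; pose c := chart_at p.
have ac : atlas c by exact: chart_at_atlas.
have cp : cdom c p by exact: chart_at_dom.
have : nbhs (c p) (c @` (U `&` cdom c)).
  by apply: open_nbhs_nbhs; split; [exact: chart_image_open|exists p].
move=> /nbhs_ballP[e /= e0 eU].
have e2 : 0 < e / 2 by rewrite divr_gt0.
have [beta [Cb b1 b0]] := exists_bump_rV (c p) e2.
pose K := closed_ball (c p) (e / 2).
have KU : K `<=` c @` (U `&` cdom c).
  apply: subset_trans eU; apply: closed_ball_subset => //.
  by rewrite ltr_pdivrMr// ltr_pMr// ltr1n.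
pose F := cinv c @` K.
have FU : F `<=` U `&` cdom c.
  by move=> _ [x /KU[q [Uq cq] <-] <-]; rewrite cmapK.
have cF : closed F.
  apply: compact_closed; first exact: points_hausdorff.
  apply: continuous_compact.
    apply: continuous_in_subspaceT => x /set_mem /KU[q [Uq cq] <-].
    by apply: cinv_continuous; exists q.
  apply: bounded_closed_compact; last exact: closed_ball_closed.
  exists (`|c p| + e / 2); split; first exact: num_real.
  move=> x xe y; rewrite /K closed_ballE//= => Ky.
  rewrite (le_trans _ (ltW xe))// -[y](subKr (c p)).
  by rewrite (le_trans (ler_normB _ _))// lerD2l.
pose b (q : M) : R^o := if `[< cdom c q >] then beta (c q) else 0.
have bF q : ~ F q -> b q = 0.
  rewrite /b; case: asboolP => // cq Fq; apply: b0 => Kq; apply: Fq.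
  by exists (c q); [exact: subset_closed_ball|rewrite cmapK].
exists b; split.
- apply: smooth_fun_local => q _.
  have [cq|ncq] := pselect (cdom c q).
    exists (cdom c) => //.
    apply: (@smooth_fun_eq _ _ _ _ _ (beta \o c)); first exact: cdom_open.
      by move=> x /set_mem cx; rewrite /b /= ifT//; exact/asboolP.
    apply: smooth_fun_chart => //; first exact: cdom_open.
    by move=> k; exact: class_C_sub (Cb k).
  exists (~` F) => [/FU[]//|].
  apply: (@smooth_fun_eq _ _ _ _ _ (fun=> 0)); first exact: closed_openC.
    by move=> x /set_mem /bF ->.
  exact: smooth_fun_cst.
- have [V [oV Vp] Vb] : exists2 V, open V /\ V p & forall q, V q -> b q = 1.
    have : \forall q \near p, beta (c q) = 1.
      have cc : {for p, continuous c} by exact: cmap_continuous.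
      exact: (cc _ b1).
    move=> near1; exists ([set q | beta (c q) = 1]° `&` cdom c).
      split; last by split.
      by apply: openI; [exact: open_interior|exact: cdom_open].
    by move=> q [/interior_subset/= Hq cq]; rewrite /b ifT//; exact/asboolP.
  by exists V.
- by exists F; split => //; apply: subset_trans FU _; exact: subIsetl.
Qed.

Section Fields.
Context {R : realType} {m n : nat} {M : manifold R m} {N : manifold R n}.
Implicit Types (h : M -> N) (U : set M) (V : M -> 'rV[R]_n).

Lemma open_preimage h (U : set N) : smooth_map h -> open U -> open (h @^-1` U).
Proof. by move=> [ch _] oU; apply: open_comp oU => x _; exact: ch. Qed.

Lemma smooth_along_sum h U (k : nat) (a : 'I_k -> R) (s : 'I_k -> M -> 'rV[R]_n) :
  smooth_map h -> open U -> (forall i, smooth_along h U (s i)) ->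
  smooth_along h U (fun p => \sum_i a i *: s i p).
Proof.
move=> sh oU ss c ac.
have oV : open (U `&` h @^-1` cdom c).
  by apply: openI => //; apply: open_preimage => //; exact: cdom_open.
apply: (@smooth_fun_eq _ _ _ _ _
  (fun p => \sum_i (a i : R^o) *: dirder c (h p) (s i p))) => //.
  by move=> p _; rewrite /dirder linear_sum; apply: eq_bigr => i _; rewrite linearZ.
apply: smooth_fun_sum => // i; apply: smooth_fun_scale => //.
  exact: smooth_fun_cst.
exact: ss.
Qed.

(** A local field times a bump function is a global field that agrees with the
    local one near p. *)
Lemma cutoff_field h U V p : smooth_map h -> open U -> U p ->
  smooth_along h U V ->
  exists b : M -> R^o,
    [/\ smooth_along h setT (fun q => b q *: V q),
        exists W, [/\ open W, W p & forall q, W q -> b q = 1] &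
        forall q, ~ U q -> b q = 0].
Proof.
move=> sh oU Up sV; have [b [sb b1 [F [cF FU b0]]]] := exists_bump oU Up.
exists b; split => //; last by move=> q nUq; apply: b0 => /FU.
move=> c ac.
have oc : open (h @^-1` cdom c) by apply: open_preimage => //; exact: cdom_open.
apply: smooth_fun_local => q [_ cq]; have [Uq|nUq] := pselect (U q).
  exists (U `&` h @^-1` cdom c) => //.
  apply: (@smooth_fun_eq _ _ _ _ _ (fun p => b p *: dirder c (h p) (V p))).
  - exact: openI.
  - by move=> x _; rewrite /dirder linearZ.
  apply: smooth_fun_scale; first exact: openI.
    by apply: smooth_fun_sub sb.
  exact: sV.
have oF : open (~` F `&` h @^-1` cdom c) by apply: openI => //; exact: closed_openC.
exists (~` F `&` h @^-1` cdom c); first by split => // /FU.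
apply: (@smooth_fun_eq _ _ _ _ _ (fun=> 0)) => //.
  by move=> x /set_mem[Fx _]; rewrite b0// scale0r /dirder linear0.
exact: smooth_fun_cst.
Qed.

End Fields.

Section CoordinateFields.
Context {R : realType} {n : nat} {N : manifold R n}.
Implicit Types (c d : chart R n N).

Lemma smooth_map_id : smooth_map (idfun : N -> N).
Proof.
split=> [x|c ac]; first exact: cvg_id.
exact: chart_smooth ac.
Qed.

(* The field with constant components [v] in the chart [c]. *)
Definition coord_field c (v : 'rV[R]_n) : field N :=
  fun q => chart_change c (chart_at q) q v.

(** In a chart d the field has components 'd (d o c^-1) (c y) v, a derivative of
    a change of charts. *)
Lemma coord_field_smooth c v :
  atlas c -> smooth_along (idfun : N -> N) (cdom c) (coord_field c v).
Proof.
move=> ac d ad; have ocd : open (cdom c `&` cdom d) by apply: openI; exact: cdom_open.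
apply: (@smooth_fun_eq _ _ _ _ _ ((fun x => 'd (d \o cinv c) x v) \o c)) => //.
  move=> q /set_mem[cq dq]; apply/esym.
  by apply: (chart_change_comp v ac (chart_at_atlas q) ad) => //; exact: chart_at_dom.
apply: smooth_fun_chart => //.
move=> k; have [_ H] := atlas_compatible ac ad k.+1.
exact: H.
Qed.

Lemma extend_coord_field c v (q : N) : atlas c -> cdom c q ->
  exists Z : field N, smooth_field Z /\
    exists W, [/\ open W, W q, W `<=` cdom c &
      forall y, W y -> Z y = coord_field c v y].
Proof.
move=> ac cq.
have [b [sb [W [oW Wq W1]] _]] :=
  cutoff_field smooth_map_id (@cdom_open _ _ _ c) cq (coord_field_smooth v ac).
exists (fun y => b y *: coord_field c v y); split => //.
exists (W `&` cdom c); split => //.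
- by apply: openI => //; exact: cdom_open.
- by move=> y [Wy _]; rewrite W1// scale1r.
Qed.

Lemma extend_tangent_vector (q : N) (v : 'rV[R]_n) :
  exists2 Z : field N, smooth_field Z & Z q = v.
Proof.
have [Z [sZ [W [_ Wq _ WZ]]]] :=
  extend_coord_field v (chart_at_atlas q) (chart_at_dom q).
exists Z => //; rewrite WZ// /coord_field chart_change_id//.
exact: chart_at_dom.
Qed.

End CoordinateFields.

(** The components of V in a chart c around h p serve as coefficients, and the
    coordinate fields of c, cut off away from h p, as global ambient fields. *)
Lemma pullback_value_exists (R : realType) (m n : nat) (M : manifold R m)
    (N : manifold R n) (h : M -> N) (nabla : connection N)
    (X V : M -> 'rV[R]_n) p :
    smooth_map h -> smooth_along h setT V -> X p \in tangent_bundle h p ->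
  exists w, pullback_value h nabla X V p w.
Proof.
move=> sh sV /memv_imgP[x _ Xp].
have {}Xp : tangent_map h p x = X p by rewrite Xp lfunE.
have [X' sX' X'p] := extend_tangent_vector (h p) (X p).
set c := chart_at (h p).
have ac : atlas c by exact: chart_at_atlas.
have cp : cdom c (h p) by exact: chart_at_dom.
have /choice[Z HZ] : forall i : 'I_n, exists Z : field N, smooth_field Z /\
    exists W, [/\ open W, W (h p), W `<=` cdom c &
      forall y, W y -> Z y = coord_field c (delta_mx 0 i) y].
  by move=> i; exact: extend_coord_field.
have /choice[W HW] := fun i => (HZ i).2.
pose U : set M := h @^-1` (cdom c `&` [set y | forall i, W i y]°).
pose f (i : 'I_n) (y : M) : R := dirder c (h y) (V y) 0 i.
exists (\sum_(i < n) (dirder (f i : M -> R^o) p x *: Z i (h p) +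
                      f i p *: nabla X' (Z i) (h p))).
exists x, X', U, n, f, Z; split => //.
- by split => // i; have [] := HZ i.
- have oU : open U.
    apply: open_preimage => //; apply: openI; first exact: cdom_open.
    exact: open_interior.
  split => //.
    split => //; apply: filter_forall => i; have [oW Wp _ _] := HW i.
    by apply: open_nbhs_nbhs.
  move=> i; apply: smooth_fun_coord => //.
  by apply: smooth_fun_sub (sV c ac) => y [cy _].
- move=> y [cy /interior_subset/= Wy].
  transitivity (\sum_(i < n) f i y *: coord_field c (delta_mx 0 i) (h y)); last first.
    by apply: eq_bigr => i _; have [_ _ _ ->] := HW i.
  (* V y, taken to the chart c and back *)
  rewrite /coord_field.
  transitivity (chart_change c (chart_at (h y)) (h y) (dirder c (h y) (V y))).
    rewrite (chart_change_comp _ (chart_at_atlas (h y)) ac (chart_at_atlas (h y)))//.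
    - by rewrite chart_change_id//; exact: chart_at_dom.
    - exact: chart_at_dom.
    - exact: chart_at_dom.
  rewrite {1}(row_sum_delta (dirder c (h y) (V y))) /chart_change linear_sum.
  by apply: eq_bigr => i _; rewrite linearZ.
Qed.

Lemma smooth_fun_comp (R : realType) (m n : nat) (M : manifold R m)
    (N : manifold R n) (W : normedModType R) (h : M -> N) (U : set N)
    (f : N -> W) :
  smooth_map h -> open U -> smooth_fun U f -> smooth_fun (h @^-1` U) (f \o h).
Proof.
move=> sh oU sf; apply: smooth_fun_local => q Uq.
set c := chart_at (h q); have ac : atlas c by exact: chart_at_atlas.
have oUc : open (h @^-1` (U `&` cdom c)).
  by apply: open_preimage => //; apply: openI => //; exact: cdom_open.
exists (h @^-1` (U `&` cdom c)); first by split => //; exact: chart_at_dom.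
move=> d ad k; have od := @chart_image_open _ _ _ d _ oUc.
apply: (@class_C_eq _ _ _ k _ (fun x => (f \o cinv c) ((c \o h) (cinv d x)))) => //.
  by move=> _ /set_mem[y [[Uy cy] dy] <-] /=; rewrite !cmapK// cmapK.
apply: (class_C_comp od _ _ (sf c ac k)).
  by move=> _ [y [[Uy cy] dy] <-] /=; rewrite cmapK//; exists (h y).
apply: class_C_sub (sh.2 c ac d ad k).
by move=> _ [y [[Uy cy] dy] <-]; exists y.
Qed.

(** * Orthogonality and the transversal decomposition *)

Lemma linear_funP (R : nzRingType) (V : lmodType R) (f : V -> R^o) :
  linear f -> exists L : {linear V -> R^o}, f = L.
Proof.
move=> lf; pose L : {linear V -> R^o} :=
  HB.pack f (GRing.isLinear.Build R V R^o *:%R f lf).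
by exists L.
Qed.

Section SpanAndKernels.
Context {R : realType} {n : nat}.

Lemma dim_lker_form (f : 'Hom('rV[R]_n, R^o)) : (n <= \dim (lker f) + 1)%N.
Proof.
have := limg_ker_dim f fullv; rewrite capfv dimvf /dim /= mul1n => {1}<-.
by rewrite leq_add2l (leq_trans (dimvS (subvf _)))// dimvf.
Qed.

(** Each linear equation lowers the dimension by at most one. *)
Lemma dim_bigcap_lker k (f : 'I_k -> 'Hom('rV[R]_n, R^o)) :
  (n <= \dim (\bigcap_(i < k) lker (f i))%VS + k)%N.
Proof.
elim: k f => [|k IH] f; first by rewrite big_ord0 dimvf /dim /= mul1n addn0.
rewrite big_ord_recl; set A := lker _; set B := (\bigcap_(i < k) _)%VS.
have HA : (n <= \dim A + 1)%N by exact: dim_lker_form.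
have HB : (n <= \dim B + k)%N by exact: IH.
have HS := dimv_sum_cap A B.
have HF : (\dim (A + B) <= n)%N.
  by rewrite (leq_trans (dimvS (subvf _)))// dimvf /dim /= mul1n.
move: HA HB HS HF; set x := \dim A; set y := \dim B; set z := \dim (A + B).
set t := \dim (A :&: B); lia.
Qed.

Lemma mem_span_family (r : nat) (s : 'I_r -> 'rV[R]_n) v :
  v \in <<[seq s i | i : 'I_r]>>%VS -> exists a : 'I_r -> R, v = \sum_i a i *: s i.
Proof.
rewrite (_ : [seq s i | i : 'I_r] = [tuple s i | i < r])//.
move=> /coord_span ->; exists (fun i => coord [tuple s i | i < r] i v).
by apply: eq_bigr => i _; rewrite -tnth_nth tnth_mktuple.
Qed.

End SpanAndKernels.

Section BilinearForm.
Context {R : realType} {n : nat} (b : 'rV[R]_n -> 'rV[R]_n -> R).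
Hypothesis b_lin : forall u, linear (b u : _ -> R^o).
Hypothesis b_sym : forall u v, b u v = b v u.
Implicit Types (U V T S St L : {vspace 'rV[R]_n}).

Lemma bformDr u v w : b u (v + w) = b u v + b u w.
Proof. by have [l ->] := linear_funP (b_lin u); rewrite linearD. Qed.

Lemma bformZr u a v : b u (a *: v) = a * b u v.
Proof. by have [l ->] := linear_funP (b_lin u); rewrite linearZ. Qed.

Lemma bform0r u : b u 0 = 0.
Proof. by have [l ->] := linear_funP (b_lin u); rewrite linear0. Qed.

Lemma bformNr u v : b u (- v) = - b u v.
Proof. by have [l ->] := linear_funP (b_lin u); rewrite linearN. Qed.

Lemma bform_sumr u (I : Type) (s : seq I) (F : I -> 'rV[R]_n) :
  b u (\sum_(i <- s) F i) = \sum_(i <- s) b u (F i).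
Proof. by have [l ->] := linear_funP (b_lin u); rewrite linear_sum. Qed.

Lemma mem_orthovP U v : reflect (forall u, u \in U -> b v u = 0) (v \in Defs.orthov b U).
Proof. by apply: (iffP idP) => /(Defs.mem_orthov U v b_lin b_sym). Qed.

Lemma dim_orthov U : (n <= \dim (Defs.orthov b U) + \dim U)%N.
Proof. exact: dim_bigcap_lker. Qed.

(** The vectors xi_i detect the elements of L by duality and annihilate T and St.
    Thus L meets St trivially, and T meets L + St trivially. Moreover dim L is at
    least r, so that dim (L + St) >= r + dim St = dim T^perp >= n - dim T, and
    the direct sum fills the space. *)
Lemma transversal_decomposition (r : nat) T St L
    (xi nl : 'I_r -> 'rV[R]_n) :
    \dim (T :&: Defs.orthov b T) = r ->
    (T :&: Defs.orthov b T = <<[seq xi i | i : 'I_r]>>)%VS ->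
    ((T :&: Defs.orthov b T) + St = Defs.orthov b T)%VS ->
    ((T :&: Defs.orthov b T) :&: St = 0)%VS ->
    L = <<[seq nl i | i : 'I_r]>>%VS ->
    (forall i j, b (xi i) (nl j) = (i == j)%:R) ->
  (T :&: (L + St) = 0)%VS /\ (T + (L + St) = fullv)%VS.
Proof.
set Rad := (T :&: Defs.orthov b T)%VS => dR RadE sumSt capSt LE dual.
have Lxi a j : b (xi j) (\sum_i a i *: nl i) = a j.
  rewrite bform_sumr (bigD1 j)//= bformZr dual eqxx mulr1 big1 ?addr0// => i ij.
  by rewrite bformZr dual eq_sym (negbTE ij) mulr0.
have xiRad j : xi j \in Rad.
  by rewrite RadE memv_span//; apply/mapP; exists j => //; rewrite mem_enum.
have xiT j : xi j \in T by have := xiRad j; rewrite memv_cap => /andP[].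
have xiN j : xi j \in Defs.orthov b T by have := xiRad j; rewrite memv_cap => /andP[].
have StN s : s \in St -> s \in Defs.orthov b T.
  by move=> sSt; rewrite -sumSt; apply: (subvP (addvSr _ _)).
have L0 l : l \in L -> (forall j, b (xi j) l = 0) -> l = 0.
  rewrite LE => /mem_span_family[a ->] H; rewrite big1// => i _.
  by rewrite -(Lxi a) H scale0r.
have xiSt j s : s \in St -> b (xi j) s = 0.
  by move=> /StN/mem_orthovP H; rewrite b_sym H.
have capL : (L :&: St = 0)%VS.
  apply/eqP; rewrite -subv0; apply/subvP => v; rewrite memv_cap => /andP[vL vSt].
  by rewrite memv0; apply/eqP/L0 => // j; exact: xiSt.
have capT : (T :&: (L + St) = 0)%VS.
  apply/eqP; rewrite -subv0; apply/subvP => v; rewrite memv_cap memv0.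
  move=> /andP[vT /memv_addP[l lL [s sSt vE]]].
  have l0 : l = 0.
    apply: L0 => // j; have := mem_orthovP _ _ (xiN j) v vT.
    by rewrite vE bformDr (xiSt j s sSt) addr0.
  have : s \in (Rad :&: St)%VS.
    rewrite memv_cap sSt andbT memv_cap StN// andbT.
    by move: vE vT; rewrite l0 add0r => ->.
  by rewrite capSt memv0 vE l0 add0r.
split => //; apply/eqP; rewrite eqEdim subvf /=.
(* duality with the xi_i makes the nl_i linearly independent *)
have dL : (r <= \dim L)%N.
  suff : free [tuple nl i | i < r].
    rewrite /free size_tuple => /eqP <-.
    by rewrite LE (_ : [seq nl i | i : 'I_r] = [tuple nl i | i < r]).
  apply/freeP => a E j; rewrite -(Lxi a) -[RHS](bform0r (xi j)); congr b.
  by rewrite -[RHS]E; apply: eq_bigr => i _; rewrite -tnth_nth tnth_mktuple.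
have dN : \dim (Defs.orthov b T) = (r + \dim St)%N.
  by rewrite -sumSt dimv_disjoint_sum// dR.
have := dim_orthov T.
rewrite dimv_disjoint_sum// dimv_disjoint_sum// dN dimvf /dim /= mul1n.
lia.
Qed.

Lemma orthogonal_projection_eq T U v w :
    (T :&: U = 0)%VS -> (T + U = fullv)%VS -> (forall u, u \in U -> b v u = 0) ->
  b v (daddv_pi T U w) = b v w.
Proof.
move=> cap sum H; rewrite -[in RHS](@daddv_pi_add _ _ T U w)// ?sum ?memvf//.
by rewrite bformDr [X in _ + X]H ?addr0//; exact: memv_pi.
Qed.

End BilinearForm.

(** * The Levi-Civita connection along the submanifold *)

Lemma section_through (R : realType) (m n k : nat) (M : manifold R m)
    (N : manifold R n) (h : M -> N) (E : M -> {vspace 'rV[R]_n}) p u :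
    smooth_map h -> subbundle_rank h k E -> u \in E p ->
  exists2 X, is_section h E X & X p = u.
Proof.
move=> sh [_ /(_ p)[U [s [oU Up ss Es]]]].
rewrite (Es p Up) => /mem_span_family[a ->].
have sV := smooth_along_sum a sh oU ss.
have [b [sb [W [_ Wp W1]] b0]] := cutoff_field sh oU Up sV.
exists (fun q => b q *: \sum_i a i *: s i q); last by rewrite W1// scale1r.
split => // q; have [Uq|nUq] := pselect (U q); last by rewrite b0// scale0r mem0v.
rewrite memvZ// memv_suml// => i _; rewrite memvZ// (Es q Uq) memv_span//.
by apply/mapP; exists i => //; rewrite mem_enum.
Qed.

(** If V = \sum_i f_i (Z_i o h) is everywhere orthogonal to nu, the derivative of
    \sum_i f_i g(Z_i, nu) o h along X is 0. Expanding it with the Leibniz rule and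
    the metric property of nabla gives g(w, nu) + g(V, nabla_X nu) = 0. *)
Lemma pullback_connection_metric (R : realType) (m n : nat) (M : manifold R m)
    (N : manifold R n) (h : M -> N) (g : metric_tensor N) (q : nat)
    (nabla : connection N) (nu : field N) (X V : M -> 'rV[R]_n) p w :
    smooth_map h -> semi_riemannian g q -> smooth_field nu ->
    (forall X' Z, smooth_field X' -> smooth_field Z ->
       fderiv X' (fun y => g y (Z y) (nu y)) (h p) =
       g (h p) (nabla X' Z (h p)) (nu (h p)) +
       g (h p) (Z (h p)) (nabla X' nu (h p))) ->
    (forall y, g (h y) (V y) (nu (h y)) = 0) ->
    pullback_value h nabla X V p w ->
  exists X' : field N, [/\ smooth_field X', X' (h p) = X p &
    g (h p) w (nu (h p)) = - g (h p) (V p) (nabla X' nu (h p))].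
Proof.
move=> sh [gls _ gsm _] snu comp Vnu.
move=> [x [X' [U [k [f [Z [[hx X'p] [sX' sZ] [oU Up sf] VE ->]]]]]]].
exists X'; split => //.
have gl y u := (gls y u).1; have gs y u v := (gls y u).2 v.
pose G i y : R^o := g y (Z i y) (nu y).
have sG i : smooth_fun setT (G i) by exact: gsm.
have sGh i : smooth_fun U (G i \o h).
  by apply: smooth_fun_sub (smooth_fun_comp sh openT (sG i)).
have Gh i : dirder (G i \o h) p x =
    g (h p) (nabla X' (Z i) (h p)) (nu (h p)) +
    g (h p) (Z i (h p)) (nabla X' nu (h p)).
  rewrite (dirder_comp _ sh openT _ (sG i))// hx -X'p.
  exact: comp.
(* the Leibniz rule applied to g(V, nu) = 0 *)
have E : \sum_(i < k) (dirder (f i : M -> R^o) p x * G i (h p) +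
                       f i p * dirder (G i \o h) p x) = 0.
  transitivity (dirder (fun y => \sum_(i < k) (f i y : R^o) *: (G i \o h) y) p x).
    have sfG i : smooth_fun U (fun y => (f i y : R^o) *: (G i \o h) y).
      by apply: smooth_fun_scale => //; exact: sf.
    rewrite (dirder_sum _ _ oU Up sfG); apply: eq_bigr => i _.
    by rewrite (dirder_scale _ Up (sf i) (sGh i)).
  have -> : dirder (fun y => \sum_(i < k) (f i y : R^o) *: (G i \o h) y) p x =
            dirder (fun=> 0 : R^o) p x.
    apply: (@dirder_eq _ _ _ _ U) => //; last exact: smooth_fun_cst.
    move=> y /set_mem Uy; rewrite -[LHS](Vnu y) gs VE// bform_sumr//.
    by apply: eq_bigr => i _; rewrite bformZr// [g _ (nu _) _]gs.
  exact: (congr1 (@^~ x) (@diff_cst _ _ R^o 0 (chart_at p p))).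
apply/eqP; rewrite -addr_eq0 -[X in _ == X]E.
rewrite gs [g (h p) (V p) _]gs VE// !bform_sumr// -big_split /=; apply/eqP.
apply: eq_bigr => i _; rewrite bformDr// !bformZr// Gh /G !(gs _ (nu _)).
by rewrite [g _ (nabla _ _ _) (Z _ _)]gs mulrDr addrA.
Qed.

(** Duality used for (Y, Z) and for (Z, Y), and averaged. *)
Lemma mean_connection_metric (R : realType) (n : nat) (N : manifold R n)
    (g : metric_tensor N) (q : nat) (nabla nablas : connection N) X Y Z p :
    semi_riemannian g q -> dual_connections g nabla nablas ->
    smooth_field X -> smooth_field Y -> smooth_field Z ->
  fderiv X (fun y => g y (Y y) (Z y)) p =
  g p (mean_connection nabla nablas X Y p) (Z p) +
  g p (Y p) (mean_connection nabla nablas X Z p).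
Proof.
move=> [gls _ _ _] dual sX sY sZ.
have gl y u := (gls y u).1; have gs y u v := (gls y u).2 v.
have E1 := dual X Y Z sX sY sZ p.
have E2 := dual X Z Y sX sZ sY p.
have E : fderiv X (fun y => g y (Y y) (Z y)) p = fderiv X (fun y => g y (Z y) (Y y)) p.
  by congr fderiv; apply/funext => y; rewrite gs.
rewrite -E in E2; rewrite /mean_connection; move: E1 E2.
move: (fderiv _ _ _) (nabla X Y p) (nablas X Y p) (nabla X Z p) (nablas X Z p).
move: (Y p) (Z p) => y z F a a' c c' {E dual}.
rewrite [g p a z]gs [g p c y]gs [g p (2^-1 *: _) z]gs !bformZr// !bformDr//.
move: (g p z a) (g p z a') (g p y c) (g p y c') => r1 r2 r3 r4; lra.
Qed.

(** * The contradiction with total geodesy *)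

(** A nonzero u in E lies in S, hence outside the radical, hence pairs nontrivially
    with some tangent vector; the components of the latter in Rad, E' and <nu>
    are orthogonal to u, so that its component in E pairs nontrivially with u. *)
Lemma screen_part_nondegenerate (R : realType) (m n k : nat) (M : manifold R m)
    (N : manifold R n) (iota : M -> N) (g : metric_tensor N) (nu : field N)
    (S E E' : M -> {vspace 'rV[R]_n}) (p : M) :
    (forall u, linear (g (iota p) u : _ -> R^o)) ->
    (forall u v, g (iota p) u v = g (iota p) v u) ->
    complement_in (radical iota g) S (tangent_bundle iota) ->
    S p = (E p + (E' p + <[nu (iota p)]>))%VS ->
    orthogonal_spaces (g (iota p)) (E p) (E' p) ->
    orthogonal_spaces (g (iota p)) (E p) <[nu (iota p)]>%VS ->
    (0 < k)%N -> subbundle_rank iota k E ->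
  exists u v, [/\ u \in E p, v \in E p & g (iota p) u v != 0].
Proof.
move=> gl gs comp SE oE' onu k0 [dE _].
have [sumS capS] := comp p.
set u := vpick (E p).
have uE : u \in E p by exact: memv_pick.
have u0 : u != 0 by rewrite vpick0 -dimv_eq0 dE -lt0n.
have uS : u \in S p by rewrite SE; apply: (subvP (addvSl _ _)).
have uT : u \in tangent_bundle iota p by rewrite -sumS; apply: (subvP (addvSr _ _)).
have : u \notin Defs.orthov (g (iota p)) (tangent_bundle iota p).
  apply: contra u0 => uN; rewrite -memv0 -capS memv_cap uS andbT.
  by rewrite /radical memv_cap uT.
move=> /(mem_orthovP gl gs) H.
have [t [tT ut]] : exists t, t \in tangent_bundle iota p /\ g (iota p) u t != 0.
  apply: contrapT => K; apply: H => t tT; apply/eqP; apply: contrapT => /negP ut.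
  by apply: K; exists t.
move: tT ut; rewrite -sumS => /memv_addP[x xR [s sS ->]].
move: sS; rewrite SE => /memv_addP[v vE [_ /memv_addP[e eE' [w wnu ->]] ->]].
rewrite !bformDr// (oE' u e)// (onu u w)// !addr0.
have -> : g (iota p) u x = 0.
  move: xR; rewrite /radical memv_cap => /andP[_ /(mem_orthovP gl gs) xN].
  by rewrite gs xN.
by rewrite add0r => uv; exists u, v.
Qed.

Section NotTotallyGeodesic.
Context (R : realType) (n m q r : nat) (Mbar : manifold R n)
  (g : metric_tensor Mbar) (nabla nablas : connection Mbar)
  (phi : Mbar -> 'End('rV[R]_n)) (nu : field Mbar)
  (eta : Mbar -> 'Hom('rV[R]_n, R^o))
  (M : manifold R m) (iota : M -> Mbar)
  (S St L : M -> {vspace 'rV[R]_n}).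
Hypothesis Mbar_kenmotsu : kenmotsu_statistical g q nabla nablas phi nu eta.
Hypothesis M_lightlike : lightlike_submanifold iota g r S St L.
Hypothesis nu_screen : forall p, nu (iota p) \in S p.

(** The transversal part of the ambient derivative is orthogonal to nu, which
    removes the projection; what is left is the identity
    g(nabla_X Y, nu) = - g(Y, nabla_X nu) = g(X, Y). *)
Lemma induced_connection_nu (X Y : M -> 'rV[R]_n) p :
    smooth_along iota setT Y -> X p \in tangent_bundle iota p ->
    g (iota p) (X p) (nu (iota p)) = 0 ->
    (forall y, g (iota y) (Y y) (nu (iota y)) = 0) ->
  g (iota p) (induced_connection iota (mean_connection nabla nablas) St L X Y p)
             (nu (iota p)) = g (iota p) (X p) (Y p).
Proof.
move=> sY XT Xnu Ynu.
have [[imm _] [_ [dR _]] [_ compS] [_ compSt] ltr] := M_lightlike.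
have [[sr _ _ _ dual] acm _ lcnu _] := Mbar_kenmotsu.
have [[snu _ _] _ _ _ etaE] := acm.
have [gls _ _ _] := sr.
have gl y u := (gls y u).1; have gs y u v := (gls y u).2 v.
have [sumS capS] := compS p; have [sumSt capSt] := compSt p.
have [U [xi [nl [_ Up _ /(_ p Up)[RE LE nlO dualE _]]]]] := ltr p.
have [capT sumT] := transversal_decomposition (gl (iota p)) (gs (iota p))
  (dR p) RE sumSt capSt LE dualE.
have nuT : nu (iota p) \in tangent_bundle iota p.
  by rewrite -sumS; apply: (subvP (addvSr _ _)).
have trnu u : u \in (L p + St p)%VS -> g (iota p) (nu (iota p)) u = 0.
  move=> /memv_addP[l lL [s sSt ->]]; rewrite bformDr//.
  have -> : g (iota p) (nu (iota p)) s = 0.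
    have : s \in normal_bundle iota g p.
      by rewrite -sumSt; apply: (subvP (addvSr _ _)).
    by move=> /(mem_orthovP (gl _) (gs _)) sN; rewrite gs sN.
  rewrite addr0; move: lL; rewrite LE => /mem_span_family[a ->].
  rewrite (bform_sumr (gl _)) big1// => i _; rewrite (bformZr (gl _)).
  move: (nlO i); rewrite memv_cap => /andP[/(mem_orthovP (gl _) (gs _)) nO _].
  by rewrite gs nO ?mulr0.
rewrite gs (orthogonal_projection_eq (gl _))//.
have : pullback_value iota (mean_connection nabla nablas) X Y p
   (pullback_connection iota (mean_connection nabla nablas) X Y p).
  by apply: getPex; exact: pullback_value_exists.
case/(pullback_connection_metric imm sr snu _ Ynu).
  by move=> X' Z sX' sZ; exact: mean_connection_metric sr dual sX' sZ snu.
move=> X' [sX' X'p E].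
rewrite gs E lcnu// X'p bformDr// bformNr// bformZr// Ynu mulr0 addr0 opprK.
by rewrite gs.
Qed.

(** E' is where nondegeneracy is available and E where total geodesy is assumed:
    they differ for D + Rad(TM), on which g itself is degenerate. *)
Lemma not_totally_geodesic (k : nat) (E E' : M -> {vspace 'rV[R]_n}) p u v :
    subbundle_rank iota k E' -> (forall y, (E' y <= E y)%VS) ->
    (forall y, (E y <= tangent_bundle iota y)%VS) ->
    (forall y, orthogonal_spaces (g (iota y)) (E y) <[nu (iota y)]>%VS) ->
    u \in E' p -> v \in E' p -> g (iota p) u v != 0 ->
  ~ totally_geodesic iota (mean_connection nabla nablas) St L E.
Proof.
move=> sbE' E'E ET Enu uE' vE' guv tg.
have [imm _ _ _ _] := M_lightlike.
have [X sX Xp] := section_through imm.1 sbE' uE'.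
have [Y sY Yp] := section_through imm.1 sbE' vE'.
have toE Z : is_section iota E' Z -> is_section iota E Z.
  by move=> [sZ ZE']; split => // y; exact: (subvP (E'E y)).
have nu0 y w : w \in E y -> g (iota y) w (nu (iota y)) = 0.
  by move=> wE; apply: Enu => //; exact: memv_line.
have [_ /(_ p) /nu0] := tg X Y (toE _ sX) (toE _ sY).
have [sYa YE] := toE _ sY; have [_ XE] := toE _ sX.
rewrite induced_connection_nu//.
- by rewrite Xp Yp => /eqP; rewrite (negbTE guv).
- exact: (subvP (ET p)).
- exact: nu0.
- by move=> y; exact: nu0.
Qed.

End NotTotallyGeodesic.

Theorem theorem5p7 (R : realType) (n m q r : nat)
    (Mbar : manifold R n.*2.+1)
    (g : metric_tensor Mbar) (nabla nablas : connection Mbar)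
    (phi : Mbar -> 'End('rV[R]_(n.*2.+1))) (nu : field Mbar)
    (eta : Mbar -> 'Hom('rV[R]_(n.*2.+1), R^o))
    (M : manifold R m) (iota : M -> Mbar)
    (S St L D Dperp : M -> {vspace 'rV[R]_(n.*2.+1)})
    (q_ge1 : (1 <= q)%N)
    (Mbar_kenmotsu : kenmotsu_statistical g q nabla nablas phi nu eta)
    (M_nonempty : [set: M] !=set0)
    (M_lightlike : lightlike_submanifold iota g r S St L)
    (M_SCR : contact_SCR iota g phi nu S St D Dperp) :
  ~ totally_geodesic iota (mean_connection nabla nablas) St L Dperp /\
  ~ totally_geodesic iota (mean_connection nabla nablas) St L
      (fun p => (D p + radical iota g p)%VS).
Proof.
have [p _] := M_nonempty.
have [_ _ [_ compS] _ _] := M_lightlike.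
have [[[kD kD0 sD] [kP kP0 sP]] nuT SE _ _] := M_SCR.
have [[[gls _ _ _] _ _ _ _] _ _ _ _] := Mbar_kenmotsu.
have gl y u := (gls y u).1; have gs y u v := (gls y u).2 v.
have ST y : (S y <= tangent_bundle iota y)%VS.
  by have [<- _] := compS y; exact: addvSr.
have nuS y : nu (iota y) \in S y.
  by have [-> _ _ _ _] := SE y; apply: (subvP (addvSr _ _)); exact: memv_line.
have DS y : (D y <= S y)%VS.
  by have [-> _ _ _ _] := SE y; rewrite -addvA addvSl.
have PS y : (Dperp y <= S y)%VS.
  by have [-> _ _ _ _] := SE y; rewrite (addvC (D y)) -addvA addvSl.
have [SpE _ oDP oDnu oPnu] := SE p.
split.
- have [||u [v [uP vP uv]]] := @screen_part_nondegenerate _ _ _ kP _ _ iota g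
    nu S Dperp D p (gl _) (gs _) compS _ _
    oPnu kP0 sP.
  + by rewrite SpE (addvC (D p)) addvA.
  + by move=> x y xP yD; rewrite gs; exact: oDP.
  apply: (not_totally_geodesic Mbar_kenmotsu M_lightlike nuS sP _ _ _ uP vP uv) => // y.
  + exact: subv_trans (PS y) (ST y).
  + by have [_ _ _ _] := SE y.
- have [|u [v [uD vD uv]]] := @screen_part_nondegenerate _ _ _ kD _ _ iota g
    nu S D Dperp p (gl _) (gs _) compS _ oDP oDnu kD0 sD.
  + by rewrite SpE addvA.
  apply: (not_totally_geodesic Mbar_kenmotsu M_lightlike nuS sD _ _ _ uD vD uv) => // y.
  + exact: addvSl.
  + by rewrite subv_add (subv_trans (DS y) (ST y)) capvSl.
  + have [_ _ _ oD _] := SE y.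
    move=> _ w /memv_addP[d dD [x xR ->]] wnu.
    rewrite gs bformDr// [g _ w d]gs oD// add0r gs.
    move: xR; rewrite memv_cap => /andP[_ /(mem_orthovP (gl _) (gs _)) -> //].
    by move: wnu => /vlineP[a ->]; rewrite memvZ.
Qed.
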